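(* Let $\mathcal{N}=\{X_n(k)\mid k\in[0,k_{max}]\}$ be a closed natural motion trajectory and let $\mathcal{O}_i(s_i,S_i)$, $i=1,\dots,l$, be ellipsoidal exclusion zones. Suppose that (A1) the closed-loop dynamics are $X(k+1)=\bar{A}X(k)-BKX_n(k+\delta)$ and the error dynamics are $e(k+1)=\bar{A}e(k)$, where $e(k)=X(k)-X_n(k+\delta)$ and $\bar A=A+BK$ (with $\bar A$ invertible); (A2) $P=P^T>0$ is chosen such that $\bar{A}^TP\bar{A}-P=-Q$ with $Q=Q^T>0$; and that $u_{max}>0$ and $\mathcal{N}\cap\mathcal{O}_i(s_i,S_i)=\emptyset$ for $i=1,2,\dots,l$. Then there exist $\rho_k>0$ for all $k\in[0,k_{max}]$, obtained using Procedure 2 (a backward recursion starting from the safe scale factors $\rho_k^s$, defined in the context), such that the tube $$\mathcal{T}_{\mathcal{N}}=\bigcup_{k\in[0,k_{max}]}\mathcal{E}_{k,\mathcal{N}},\qquad \mathcal{E}_{k,\mathcal{N}}=\{X\in\mathbb{R}^6\mid (X-X_n(k))^TP(X-X_n(k))\le\rho_k\},$$ is safe and positively-invariant.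
   Context: Dynamics: $X=[x\ y\ z\ \dot x\ \dot y\ \dot z]^T\in\mathbb{R}^6$, $X(k+1)=AX(k)+Bu(k)$, $k\in\mathbb{Z}_{\ge0}$, $u(k)\in\mathbb{R}^3$, with $\Delta T>0$, $m>0$, $\omega>0$ and $A=\exp(A_c\Delta T)$, $B=\int_0^{\Delta T}\exp(A_c(\Delta T-s))\,ds\begin{bmatrix}0_{3\times3}\\ \frac1m I_{3\times3}\end{bmatrix}$, $$A_c=\begin{bmatrix}0&0&0&1&0&0\\0&0&0&0&1&0\\0&0&0&0&0&1\\3\omega^2&0&0&0&2\omega&0\\0&0&0&-2\omega&0&0\\0&0&-\omega^2&0&0&0\end{bmatrix}$$ (Clohessy-Wiltshire equations). $\Delta T$ is chosen so that $\tau/\Delta T\in\mathbb{Z}_{>0}$, where $\tau=2\pi/\omega$, and $k_{max}=\tau/\Delta T-1$. Closed natural motion trajectory (NMT): for an initial condition $\bar X_0$ whose components satisfy $\dot y(0)=-2\omega x(0)$, $\mathcal{N}=\{X_n(k)\mid X_n(0)=\bar X_0,\ X_n(k+1)=AX_n(k),\ k\in[0,k_{max}]\}$. The sequence is periodic, $X_n(k_{max}+1)=X_n(0)$. Here $[0,k_{max}]$ denotes integers, and any index $k$ (of $X_n(k)$, $\rho_k$, $\rho_k^s$, $\mathcal{E}_{k,\mathcal{N}}$) outside $[0,k_{max}]$ is taken to be the equivalent index in $[0,k_{max}]$ modulo $k_{max}+1$. Control: $u(k)=K(X(k)-X_n(k+\delta))$, where $\delta\in\mathbb{Z}$ is a shift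 and $K$ is a gain matrix for which $\bar A=A+BK$ is Schur (all eigenvalues in the open unit disk). Constraints: the control constraint is $\|u(k)\|_\infty\le u_{max}$. The exclusion zones are $\mathcal{O}_i(s_i,S_i)=\{X\in\mathbb{R}^6\mid(\Phi X-s_i)^TS_i(\Phi X-s_i)\le1\}$, $s_i\in\mathbb{R}^3$, $S_i=S_i^T>0$, $\Phi=[I_{3\times3}\ 0_{3\times3}]$; the exclusion zone constraints are $1-(\Phi X-s_i)^TS_i(\Phi X-s_i)\le0$, $i=1,\dots,l$. Safe scale factors: $\rho_k^s=\min\{\rho_u,\ \rho_{Oi,k},\ i=1,\dots,l\}$. Here $\rho_u$ is the largest $\rho\ge0$ such that $\|K(X-X_n(k))\|_\infty\le u_{max}$ for all $X$ with $(X-X_n(k))^TP(X-X_n(k))\le\rho$ (it does not depend on $k$). And $\rho_{Oi,k}$ is the minimum of $\rho$ over pairs $(\rho,X)$ with $(X-X_n(k))^TP(X-X_n(k))\le\rho$ and $(\Phi X-s_i)^TS_i(\Phi X-s_i)\le1$ (so it is $0$ if $X_n(k)\in\mathcal{O}_i(s_i,S_i)$). Procedure 2: for $\rho\ge0$ let $d(\rho)=\min\{(\bar A^{-1}e)^TP(\bar A^{-1}e)-e^TPe\mid e\in\mathbb{R}^6,\ e^TPe=\rho\}$. (1) Start at $k$ such that $k+1$ is an index in $[0,k_{max}]$ minimizing $\rho_j^s$ over $j\in[0,k_{max}]$ (any minimizer may be chosen), and set $\rho_{k+1}=\rho_{k+1}^s$. (2) Set $\rho_k=\rho_k^s$ if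 $\rho_k^s\le\rho_{k+1}+d(\rho_{k+1})$, and $\rho_k=\rho_{k+1}+d(\rho_{k+1})$ otherwise. (3) Decrease $k$ by one and repeat step 2; when $k=-1$, set $k=k_{max}$, and continue until returning to the starting index. Safe tube: $\mathcal{T}_{\mathcal{N}}$ is safe if for every $X\in\mathcal{T}_{\mathcal{N}}$ (viewed as the state $X=X(k)$ at a time $k$) all exclusion zone constraints hold at $X$ and there exists $\delta\in\mathbb{Z}$ such that the control constraint $\|K(X-X_n(k+\delta))\|_\infty\le u_{max}$ holds. Positive invariance: $\mathcal{T}_{\mathcal{N}}$ is positively-invariant with respect to the closed-loop dynamics if there exists $\delta\in\mathbb{Z}$ such that, for every $k_1\in\mathbb{Z}_{\ge0}$ and every sequence $(X(k))_{k\ge k_1}$ satisfying $X(k+1)=\bar AX(k)-BKX_n(k+\delta)$ for $k\ge k_1$, $X(k_1)\in\mathcal{E}_{k_1+\delta,\mathcal{N}}$ implies $X(k_2)\in\mathcal{E}_{k_2+\delta,\mathcal{N}}$ for all integers $k_2\ge k_1$. *)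

(* Defs.v *)
From HB Require Import structures.
From mathcomp Require Export all_boot all_order all_algebra.
From mathcomp Require Export all_classical all_reals all_analysis.
From mathcomp Require Import complex.
Export Order.TTheory GRing.Theory Num.Theory.
Export numFieldNormedType.Exports.

Set Implicit Arguments.
Unset Strict Implicit.
Unset Printing Implicit Defensive.

Global Open Scope classical_set_scope.
Global Open Scope ring_scope.

Section Generic.
Variable R : realType.

Definition is_max (E : set R) (x : R) : Prop := E x /\ ubound E x.
Definition is_min (E : set R) (x : R) : Prop := E x /\ lbound E x.

Definition qform n (P : 'M[R]_n) (v : 'cV[R]_n) : R := (v^T *m P *m v) 0 0.

Definition sym_posdef n (P : 'M[R]_n) : Prop :=
  P^T = P /\ forall v : 'cV[R]_n, v != 0 -> 0 < qform P v.

Definition schur n (M : 'M[R]_n) : Prop :=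
  forall z : R[i], eigenvalue (map_mx (real_complex R) M) z -> `|z| < 1.

Definition expmx n (M : 'M[R]_n.+1) : 'M[R]_n.+1 :=
  limn (series (fun k : nat => (k`!%:R : R)^-1 *: M ^+ k)).

End Generic.

Section ClohessyWiltshire.
Variable R : realType.

(* The state is (x, y, z, x', y', z'), with components indexed from 0. *)
Definition cw_Ac (omega : R) : 'M[R]_6 :=
  \matrix_(i < 6, j < 6) nth 0 (nth [::]
    [:: [:: 0; 0; 0; 1; 0; 0];
        [:: 0; 0; 0; 0; 1; 0];
        [:: 0; 0; 0; 0; 0; 1];
        [:: 3 * omega ^+ 2; 0; 0; 0; 2 * omega; 0];
        [:: 0; 0; 0; - (2 * omega); 0; 0];
        [:: 0; 0; - omega ^+ 2; 0; 0; 0] ] i) j.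

Definition cw_A (omega DT : R) : 'M[R]_6 := expmx (DT *: cw_Ac omega).

Definition cw_B (omega mass DT : R) : 'M[R]_(6, 3) :=
  (\matrix_(i < 6, j < 6)
     (\int[lebesgue_measure]_(t in `[0, DT])
        expmx ((DT - t) *: cw_Ac omega) i j))
  *m (col_mx 0 (mass^-1)%:M : 'M[R]_(3 + 3, 3)).

Definition Phi : 'M[R]_(3, 6) := (row_mx 1%:M 0 : 'M[R]_(3, 3 + 3)).

Definition exclusion_zone (s : 'cV[R]_3) (S : 'M[R]_3) : set 'cV[R]_6 :=
  [set X | qform S (Phi *m X - s) <= 1].

End ClohessyWiltshire.

Arguments Phi {R}.

Section Tube.
Variables (R : realType) (kmax : nat).
Implicit Types (A Abar P : 'M[R]_6) (K : 'M[R]_(3, 6)).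
Implicit Types (Xn : 'I_kmax.+1 -> 'cV[R]_6) (rho : 'I_kmax.+1 -> R).

(* The representative of k in [0, kmax] modulo kmax + 1. *)
Definition wrap (k : int) : 'I_kmax.+1 := inord `|(k %% kmax.+1%:Z)%Z|%N.

Definition trajectory A (X0 : 'cV[R]_6) (k : 'I_kmax.+1) : 'cV[R]_6 :=
  iter k (fun X => A *m X) X0.

Definition ellipsoid P Xn rho (k : 'I_kmax.+1) : set 'cV[R]_6 :=
  [set X | qform P (X - Xn k) <= rho k].

Definition tube P Xn rho : set 'cV[R]_6 :=
  \bigcup_(k in [set: 'I_kmax.+1]) ellipsoid P Xn rho k.

(* `| _ | on column vectors is the maximum norm. *)
Definition rho_u_set K P (umax : R) (c : 'cV[R]_6) : set R :=
  [set r | 0 <= r /\ forall X : 'cV[R]_6,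
             qform P (X - c) <= r -> `|K *m (X - c)| <= umax].

Definition rho_O_set P (s : 'cV[R]_3) (S : 'M[R]_3) (c : 'cV[R]_6) : set R :=
  [set r | exists2 X : 'cV[R]_6, qform P (X - c) <= r & exclusion_zone s S X].

(* rho_s is the family of safe scale factors; in particular, the maximum and
   the minima that enter its definition are attained. *)
Definition safe_scale_factors K P (umax : R) (l : nat)
    (s : 'I_l -> 'cV[R]_3) (S : 'I_l -> 'M[R]_3) Xn
    (rho_s : 'I_kmax.+1 -> R) : Prop :=
  forall k, exists (rho_u : R) (rho_O : 'I_l -> R),
    [/\ is_max (rho_u_set K P umax (Xn k)) rho_u,
        forall i, is_min (rho_O_set P (s i) (S i) (Xn k)) (rho_O i)
      & rho_s k = \big[Order.min/rho_u]_(i < l) rho_O i].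

Definition decrement_set Abar P (r : R) : set R :=
  [set qform P (invmx Abar *m e) - qform P e
     | e in [set e : 'cV[R]_6 | qform P e = r]].

(* rho is the outcome of the backward recursion initialized at k0 and run over
   k0 - 1, k0 - 2, ..., k0 + 1 cyclically (ordS is the cyclic successor). *)
Definition procedure2 Abar P (rho_s : 'I_kmax.+1 -> R)
    (k0 : 'I_kmax.+1) rho : Prop :=
  rho k0 = rho_s k0 /\
  forall k, k != k0 -> exists2 d : R,
    is_min (decrement_set Abar P (rho (ordS k))) d &
    rho k = if rho_s k <= rho (ordS k) + d then rho_s k else rho (ordS k) + d.

Definition safe_tube K (umax : R) (l : nat)
    (s : 'I_l -> 'cV[R]_3) (S : 'I_l -> 'M[R]_3) Xn
    (T : set 'cV[R]_6) : Prop :=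
  forall X, T X -> forall k : nat,
    (forall i, 1 - qform (S i) (Phi *m X - s i) <= 0) /\
    exists delta : int, `|K *m (X - Xn (wrap (k%:Z + delta)))| <= umax.

Definition positively_invariant Abar (BK : 'M[R]_6) P Xn rho : Prop :=
  exists delta : int, forall (k1 : nat) (X : nat -> 'cV[R]_6),
    (forall k : nat, (k1 <= k)%N ->
       X k.+1 = Abar *m X k - BK *m Xn (wrap (k%:Z + delta))) ->
    ellipsoid P Xn rho (wrap (k1%:Z + delta)) (X k1) ->
    forall k2 : nat, (k1 <= k2)%N ->
      ellipsoid P Xn rho (wrap (k2%:Z + delta)) (X k2).

End Tube.

(* Main.v *)
Require Import Defs.
From mathcomp Require Import lra ring zify.

Set Implicit Arguments.
Unset Strict Implicit.
Unset Printing Implicit Defensive.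

(** The error [e k = X k - Xn k] obeys [e k.+1 = Abar *m e k], provided that the
    reference satisfies [Xn (k + 1) = A *m Xn k] at every index, the last one
    included. This is where periodicity enters. On the states with
    [y' = - 2 omega x] the matrix [Ac] of the Clohessy-Wiltshire equations
    satisfies [Ac ^ 3 = - omega ^ 2 Ac], so that the exponential series splits
    into a sine and a cosine series ([expmx_rotation]), and a whole number of
    sampling steps filling one period [2 pi / omega] brings the state back
    ([cw_A_periodic]).

    The safe scale factors exist and are positive. The minima that define the
    distance to a zone are attained because the sublevel sets of a positive
    definite form are compact ([posdef_sublevel_compact]), and they are positive
    because the centre avoids the zone ([rho_O_min]). The maximum that defines
    the control scale exists because [K != 0] ([rho_u_max]): with a zero gain the
    closed loop would be the natural dynamics, which fixes every displacement
    along the track ([cw_A_fixes_along_track]), against the Lyapunov equation.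

    With [r = rho (k + 1)], the number [d r] is the least amount of [P] which the
    closed loop dissipates on its way to the level [r]. By homogeneity an error
    with [P]-level at most [r + d r] is therefore sent to a level at most [r]
    ([decrement_contraction]), and the recursion keeps [rho k] below that bound.
    The only step left out is the one that leaves the starting index. There
    [rho] is minimal over the whole cycle ([procedure2_ge]), and since [P]
    decreases along the closed loop this step is harmless as well
    ([procedure2_step]). Safety holds because [rho <= rho_s]. *)

(** * Continuity, norms and compactness for matrices *)

Section MatrixAnalysis.
Variable R : realType.

(** The neighbourhoods of a matrix are generated by products of neighbourhoods of
    its finitely many coordinates. *)
Lemma mx_cvg (T : Type) (F : set_system T) {FF : Filter F} m n
    (u : T -> 'M[R]_(m, n)) (l : 'M[R]_(m, n)) :
  (forall i j, u x i j @[x --> F] --> l i j) -> u x @[x --> F] --> l.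
Proof.
move=> ul A [B lB sBA].
have : \forall x \near F, forall ij : 'I_m * 'I_n, B ij.1 ij.2 (u x ij.1 ij.2).
  by apply: filter_forall => -[i j]; exact: ul (lB i j).
by apply: filterS => x Bx; apply: sBA => i j; exact: Bx (i, j).
Qed.

Lemma mx_continuous (T : topologicalType) m n (u : T -> 'M[R]_(m, n)) :
  (forall i j, continuous (fun x => u x i j)) -> continuous u.
Proof. by move=> uc x; apply: (mx_cvg (F := nbhs x)) => i j; exact: uc. Qed.

Lemma mulmx_continuous (T : topologicalType) m n p
    (f : T -> 'M[R]_(m, n)) (g : T -> 'M[R]_(n, p)) :
  continuous f -> continuous g -> continuous (fun x => f x *m g x).
Proof.
move=> fc gc; apply: mx_continuous => i j; under eq_fun do rewrite mxE.
apply: continuous_big => [|k _ x]; first exact: add_continuous.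
apply: (@continuousM _ _ (fun y => f y i k) (fun y => g y k j)).
  apply: (@continuous_comp _ _ _ f (fun A : 'M[R]_(m, n) => A i k)).
    exact: fc.
  exact: coord_continuous.
apply: (@continuous_comp _ _ _ g (fun A : 'M[R]_(n, p) => A k j)).
  exact: gc.
exact: coord_continuous.
Qed.

Lemma mulmxl_continuous m n p (A : 'M[R]_(m, n)) :
  continuous (mulmx A : 'M[R]_(n, p) -> 'M[R]_(m, p)).
Proof.
apply: (@mulmx_continuous _ _ _ _ (cst A) id) => B; last exact: id.
exact: cst_continuous.
Qed.

Lemma ler_coord_mx_norm m n (A : 'M[R]_(m, n)) i j : `|A i j| <= `|A|.
Proof.
rewrite [leRHS]/Num.norm/= mx_normrE.
exact: (@le_bigmax _ _ _ 0 (fun ij : 'I_m * 'I_n => `|A ij.1 ij.2|) (i, j)).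
Qed.

Lemma mx_norm_ler m n (A : 'M[R]_(m, n)) r :
  0 <= r -> (forall i j, `|A i j| <= r) -> `|A| <= r.
Proof.
move=> r0 Ar; rewrite [leLHS]/Num.norm/= mx_normrE.
by apply/bigmax_leP; split => // -[i j] _; exact: Ar.
Qed.

Lemma ler_norm_mulmx m n p (A : 'M[R]_(m, n)) (B : 'M[R]_(n, p)) :
  `|A *m B| <= n%:R * `|A| * `|B|.
Proof.
apply: mx_norm_ler => [|i j]; first by rewrite !mulr_ge0.
rewrite mxE (le_trans (ler_norm_sum _ _ _))//.
rewrite -mulrA mulr_natl -[n in _ *+ n]card_ord -sumr_const.
by apply: ler_sum => k _; rewrite normrM ler_pM// ler_coord_mx_norm.
Qed.

Lemma trmx_continuous m n : continuous (@trmx R m n).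
Proof.
apply: mx_continuous => i j; under eq_fun do rewrite mxE.
exact: coord_continuous.
Qed.

(** The Heine-Borel property of row vectors, carried over by transposition. *)
Lemma cV_bounded_closed_compact n (A : set 'cV[R]_n) :
  bounded_set A -> closed A -> compact A.
Proof.
move=> [M [Mreal AM]] clA.
have -> : A = @trmx R 1 n @` (@trmx R 1 n @^-1` A).
  rewrite eqEsubset; split=> [v Av|_ [v Av <-]//].
  by exists v^T; rewrite /= ?trmxK.
apply: continuous_compact.
  by apply: continuous_subspaceT; exact: trmx_continuous.
apply: bounded_closed_compact.
  exists M; split=> // x Mx v /= Av.
  apply: mx_norm_ler => [|i j].
    by rewrite (le_trans _ (AM x Mx _ Av)).
  rewrite -[v]trmxK mxE.
  by apply: le_trans (AM x Mx _ Av); exact: ler_coord_mx_norm.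
by apply: preimage_closed => // x _; exact: trmx_continuous.
Qed.

End MatrixAnalysis.

(** * Positive definite quadratic forms *)

Section QuadraticForms.
Variable R : realType.

Lemma qform0 n (P : 'M[R]_n) : qform P 0 = 0.
Proof. by rewrite /qform mulmx0 mxE. Qed.

Lemma qformZ n (P : 'M[R]_n) a v : qform P (a *: v) = a ^+ 2 * qform P v.
Proof.
by rewrite /qform linearZ/= [(a *: v)^T]linearZ/= -!scalemxAl !mxE mulrA.
Qed.

Lemma qform_ge0 n (P : 'M[R]_n) v : sym_posdef P -> 0 <= qform P v.
Proof.
by move=> [_ Ppos]; have [->|/Ppos/ltW//] := eqVneq v 0; rewrite qform0.
Qed.

Lemma qform_continuous n (P : 'M[R]_n) : continuous (qform P).
Proof.
move=> v; apply: (@continuous_comp _ _ _ (fun w : 'cV[R]_n => w^T *m P *m w)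
  (fun A : 'M[R]_1 => A 0 0)); last exact: coord_continuous.
apply: mulmx_continuous => [|w]; last exact: id.
apply: mulmx_continuous => [|w]; last exact: cst_continuous.
exact: trmx_continuous.
Qed.

Lemma posdef_scaled_to n (P : 'M[R]_n) v r : sym_posdef P -> 0 <= r ->
  v != 0 -> exists a, qform P (a *: v) = r.
Proof.
move=> [_ Ppos] r0 /Ppos v0; exists (Num.sqrt (r / qform P v)) => //.
by rewrite qformZ sqr_sqrtr ?divr_ge0 ?(ltW v0)// divfK ?gt_eqF.
Qed.

(** The form attains a minimum on the unit sphere, which is compact, and that
    minimum is positive. Homogeneity does the rest. *)
Lemma posdef_coercive n (P : 'M[R]_n) : sym_posdef P ->
  exists2 c, 0 < c & forall v, c * `|v| ^+ 2 <= qform P v.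
Proof.
move=> Pdef; have [_ Ppos] := Pdef.
pose U := [set v : 'cV[R]_n | `|v| = 1].
have [[u Uu]|U0] := pselect (U !=set0); last first.
  exists 1 => // v; have [->|v0] := eqVneq v 0.
    by rewrite normr0 expr0n mulr0 qform0.
  case: U0; exists (`|v|^-1 *: v); rewrite /U/= normrZ normfV normr_id.
  by rewrite mulVf// normr_eq0.
have cU : compact U.
  apply: cV_bounded_closed_compact.
    by exists 1; split => // x x1 v /=; rewrite /U/= => ->; exact: ltW.
  apply: (@preimage_closed _ _ _ [set 1 : R]); last exact: closed_eq.
  by move=> x _; exact: norm_continuous.
have [||w] := compact_EVT_min (f := qform P) _ cU; first by exists u.
  by apply: continuous_subspaceT; exact: qform_continuous.
rewrite inE => Uw wmin; exists (qform P w).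
  by apply: Ppos; rewrite -normr_eq0 Uw oner_eq0.
move=> v; have [->|v0] := eqVneq v 0.
  by rewrite normr0 expr0n mulr0 qform0.
have nv0 : 0 < `|v| by rewrite normr_gt0.
have /wmin : `|v|^-1 *: v \in U.
  by rewrite inE /U/= normrZ normfV normr_id mulVf ?gt_eqF.
by rewrite qformZ exprVn mulrC ler_pdivlMr ?exprn_gt0.
Qed.

Lemma posdef_sublevel_compact n (P : 'M[R]_n) r :
  sym_posdef P -> compact [set v | qform P v <= r].
Proof.
move=> /posdef_coercive[c c0 Pc].
apply: cV_bounded_closed_compact; last first.
  apply: (@preimage_closed _ _ _ [set x | x <= r]); last exact: closed_le.
  by move=> x _; exact: qform_continuous.
exists (r / c + 1); split; [exact: num_real|move=> x rx v /= vr].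
have {}vr : `|v| ^+ 2 <= r / c.
  by rewrite ler_pdivlMr// mulrC (le_trans (Pc v)).
rewrite leNgt; apply/negP => xv.
by have := normr_ge0 v; nra.
Qed.

(** Only the part of the closed set lying in one sublevel competes, and that
    part is compact. *)
Lemma posdef_closest_point n (P : 'M[R]_n) (c : 'cV[R]_n) (C : set 'cV[R]_n) :
  sym_posdef P -> closed C -> C !=set0 ->
  exists2 x, C x & forall y, C y -> qform P (x - c) <= qform P (y - c).
Proof.
move=> Pdef clC [x0 Cx0].
pose A := [set v | qform P v <= qform P (x0 - c)] `&` [set v | C (v + c)].
have cA : compact A.
  apply: compact_closedI; first exact: posdef_sublevel_compact.
  apply: preimage_closed clC => x _.
  by apply: (@continuousD _ _ _ id (cst c)); [exact: id|exact: cst_continuous].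
have [||v] := compact_EVT_min (f := qform P) _ cA.
- by exists (x0 - c); split => //=; rewrite subrK.
- by apply: continuous_subspaceT; exact: qform_continuous.
rewrite inE => -[/= vx0 Cv] vmin; exists (v + c) => // y Cy; rewrite addrK.
have [yx0|/ltW/(le_trans vx0)//] := leP (qform P (y - c)) (qform P (x0 - c)).
by apply: vmin; rewrite inE; split => //=; rewrite subrK.
Qed.

Lemma lyapunov_qform n (M P Q : 'M[R]_n) v :
  M^T *m P *m M - P = - Q -> qform P (M *m v) = qform P v - qform Q v.
Proof.
move=> /(canRL (subrK _)) lyap; apply/eqP; rewrite -subr_eq0; apply/eqP.
rewrite /qform trmx_mul.
have -> : v^T *m M^T *m P *m (M *m v) = v^T *m (M^T *m P *m M) *m v.
  by rewrite !mulmxA.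
by rewrite lyap mulmxDr mulmxDl mulmxN mulNmx !mxE; ring.
Qed.

End QuadraticForms.

(** * Scale factors and decrement *)

Section SafeScaleFactors.
Variable R : realType.

Lemma exclusion_function_continuous (s : 'cV[R]_3) (S : 'M[R]_3) :
  continuous (fun X : 'cV[R]_6 => qform S (Phi *m X - s)).
Proof.
move=> X; apply: continuous_comp; last exact: qform_continuous.
apply: (@continuousB _ _ _ (mulmx Phi) (cst s)); last exact: cst_continuous.
exact: mulmxl_continuous.
Qed.

Lemma rho_u_set_small (K : 'M[R]_(3, 6)) P (umax : R) c :
  sym_posdef P -> 0 < umax -> exists2 r, 0 < r & rho_u_set K P umax c r.
Proof.
move=> /posdef_coercive[a a0 Pa] u0.
(* a bound on the operator norm of [K], made positive by the added [1] *)
pose b := 6%:R * `|K| + 1.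
have b0 : 0 < b by rewrite ltr_wpDl// mulr_ge0.
have ub : 0 < umax / b by rewrite divr_gt0.
exists (a * (umax / b) ^+ 2); first by rewrite mulr_gt0// exprn_gt0.
split=> [|X]; first by rewrite mulr_ge0 ?ltW// exprn_gt0.
move=> /(le_trans (Pa _)); rewrite ler_pM2l//.
rewrite ler_pXn2r ?nnegrE ?(ltW ub)// => Xub.
apply: le_trans (ler_norm_mulmx _ _) _.
apply: (@le_trans _ _ (b * `|X - c|)).
  by rewrite ler_wpM2r// lerDl.
by rewrite mulrC -ler_pdivlMr.
Qed.

(** A nonzero gain produces arbitrarily large controls, so that the admissible
    levels are bounded. Their supremum is admissible since a violation at a point
    persists when that point is shrunk slightly. *)
Lemma rho_u_max (K : 'M[R]_(3, 6)) P (umax : R) c :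
  sym_posdef P -> 0 < umax -> K != 0 ->
  exists2 r, 0 < r & is_max (rho_u_set K P umax c) r.
Proof.
move=> Pdef u0 K0; set E := rho_u_set K P umax c.
have [r0 r0_gt0 Er0] := rho_u_set_small K c Pdef u0.
have [v Kv] : exists v : 'cV[R]_6, umax < `|K *m v|.
  have [j Kj] : exists j, col j K != 0.
    apply/existsP; apply: contraNT K0; rewrite negb_exists => /forallP K0.
    apply/eqP/matrixP => i j; have /negPn/eqP/colP/(_ i) := K0 j.
    by rewrite !mxE.
  have nKj : 0 < `|col j K| by rewrite normr_gt0.
  exists ((umax / `|col j K| + 1) *: delta_mx j 0).
  rewrite -scalemxAr -colE normrZ ger0_norm; last first.
    by rewrite addr_ge0// divr_ge0// ltW.
  by rewrite mulrDl divfK ?gt_eqF// mul1r ltrDl.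
have Eub : ubound E (qform P v).
  move=> r [_ Er]; rewrite leNgt; apply/negP => rv.
  have := Er (c + v); rewrite addrAC subrr add0r => /(_ (ltW rv)).
  by rewrite leNgt Kv.
have supE : has_sup E by split; [exists r0|exists (qform P v)].
have r0s : r0 <= sup E by exact: ub_le_sup supE.2 _ Er0.
exists (sup E); first exact: lt_le_trans r0s.
split; last by move=> r Er; exact: ub_le_sup supE.2 _ Er.
split=> [|X XE]; first by rewrite (le_trans _ r0s)// ltW.
rewrite leNgt; apply/negP => uX.
set e := X - c in XE uX.
have e0 : 0 < `|K *m e| := lt_trans u0 uX.
(* any factor strictly between [umax / `|K *m e|] and [1] would do *)
pose t := (umax / `|K *m e| + 1) / 2.
have uKe : umax / `|K *m e| < 1 by rewrite ltr_pdivrMr// mul1r.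
have uKe0 : 0 < umax / `|K *m e| by rewrite divr_gt0.
have t1 : t < 1 by rewrite /t; lra.
have t0 : 0 < t by rewrite /t; lra.
have ute : umax < `|K *m (t *: e)|.
  rewrite -scalemxAr normrZ gtr0_norm// -ltr_pdivrMr// /t; lra.
have te : qform P (t *: e) < sup E.
  rewrite qformZ; have [->|q0] := eqVneq (qform P e) 0.
    by rewrite mulr0 (lt_le_trans r0_gt0).
  apply: lt_le_trans XE; rewrite gtr_pMl; last by rewrite lt0r q0 qform_ge0.
  by rewrite expr_lt1// ltW.
have [r [_ Er] ter] := sup_gt supE.1 te.
have := Er (c + t *: e); rewrite addrAC subrr add0r => /(_ (ltW ter)).
by rewrite leNgt ute.
Qed.

Lemma exclusion_zone_closed (s : 'cV[R]_3) S : closed (exclusion_zone s S).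
Proof.
apply: (@preimage_closed _ _ (fun X => qform S (Phi *m X - s))
  [set x | x <= 1]); last exact: closed_le.
by move=> X _; exact: exclusion_function_continuous.
Qed.

(** The minimum over pairs of a level and a point is the level of the point of the
    zone that is closest to the centre in the [P]-metric. It is positive because
    the centre lies outside the zone. *)
Lemma rho_O_min P (s : 'cV[R]_3) (S : 'M[R]_3) (c : 'cV[R]_6) :
  sym_posdef P -> ~ exclusion_zone s S c ->
  exists2 r, 0 < r & is_min (rho_O_set P s S c) r.
Proof.
move=> Pdef cO; have [_ Ppos] := Pdef.
have [|X XO Xmin] := posdef_closest_point c Pdef (@exclusion_zone_closed s S).
  exists (col_mx s 0 : 'M[R]_(3 + 3, 1)); rewrite /exclusion_zone /= /Phi.
  by rewrite (mul_row_col 1%:M 0 s) mul1mx mul0mx addr0 subrr qform0.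
exists (qform P (X - c)).
  apply: Ppos; rewrite subr_eq0; apply/eqP => Xc.
  by apply: cO; rewrite -Xc.
split; first by exists X.
by move=> r [Y Yr YO]; exact: le_trans (Xmin Y YO) Yr.
Qed.

(** A point of the ellipsoid lying strictly inside the zone could be moved
    towards the centre without leaving the zone, which would contradict the
    minimality of the scale; so the closed ellipsoid touches the zone at most
    along its boundary. *)
Lemma rho_O_min_safe P (s : 'cV[R]_3) (S : 'M[R]_3) (c X : 'cV[R]_6) r :
  sym_posdef P -> ~ exclusion_zone s S c -> is_min (rho_O_set P s S c) r ->
  qform P (X - c) <= r -> 1 <= qform S (Phi *m X - s).
Proof.
move=> [_ Ppos] cO [_ rmin] Xr; rewrite leNgt; apply/negP => XS.
have Xc : 0 < qform P (X - c).
  apply: Ppos; rewrite subr_eq0; apply/eqP => Xc.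
  by apply: cO; rewrite -Xc; exact: ltW.
pose p t := X + t *: (c - X).
have pc : p t @[t --> 0] --> X.
  rewrite -[X in _ --> X]addr0 -(scale0r (c - X)).
  by apply: cvgD; [exact: cvg_cst|apply: cvgZr_tmp; exact: cvg_id].
have : \forall t \near 0^'+, qform S (Phi *m p t - s) < 1.
  have gc : qform S (Phi *m p t - s) @[t --> 0] --> qform S (Phi *m X - s).
    apply: (@cvg_comp _ _ _ p (fun Y => qform S (Phi *m Y - s)) _ _ _ pc).
    exact: exclusion_function_continuous.
  have /cvgr_lt/(_ _ XS) := cvg_at_right_filter gc.
  exact.
move=> pS; near (0 : R)^'+ => t.
have t0 : 0 < t by near: t; exact: nbhs_right_gt.
have t1 : t < 1 by near: t; exact: nbhs_right_lt.
have : r <= qform P (p t - c).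
  by apply: rmin; exists (p t) => //; apply: ltW; near: t.
have -> : p t - c = (1 - t) *: (X - c).
  by apply/matrixP => i j; rewrite !mxE; ring.
apply/negP; rewrite -ltNge; apply: lt_le_trans Xr; rewrite qformZ gtr_pMl//.
by rewrite expr_lt1 ?subr_ge0 ?(ltW t1)// ltrBlDr ltrDl.
Unshelve. all: by end_near. Qed.

(** By the Lyapunov equation the decrement at [e] is the [Q]-form of the preimage
    of [e]. It is positive on the level set, which is compact and avoids the
    origin. *)
Lemma decrement_min (Abar P Q : 'M[R]_6) (r : R) :
  Abar \in unitmx -> sym_posdef P -> sym_posdef Q ->
  Abar^T *m P *m Abar - P = - Q -> 0 < r ->
  exists2 d, 0 < d & is_min (decrement_set Abar P r) d.
Proof.
move=> Ainv Pdef Qdef lyap r0.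
pose f e := qform P (invmx Abar *m e) - qform P e.
pose L := [set e : 'cV[R]_6 | qform P e = r].
have cL : compact L.
  have -> : L = [set e | qform P e <= r] `&` L.
    by apply/esym/setIidr => e; rewrite /L/= => ->.
  apply: compact_closedI; first exact: posdef_sublevel_compact.
  apply: (@preimage_closed _ _ _ [set r]); last exact: closed_eq.
  by move=> e _; exact: qform_continuous.
have fc : continuous f.
  move=> e; apply: (@continuousB _ _ _ (qform P \o mulmx (invmx Abar))).
    apply: continuous_comp; last exact: qform_continuous.
    exact: mulmxl_continuous.
  exact: qform_continuous.
have [||e] := compact_EVT_min (f := f) _ cL.
- have v0 : const_mx 1 != 0 :> 'cV[R]_6.
    by apply/eqP => /colP/(_ 0)/eqP; rewrite !mxE oner_eq0.
  by have [a ar] := posdef_scaled_to Pdef (ltW r0) v0; eexists; exact: ar.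
- exact: continuous_subspaceT.
rewrite inE => Le fmin; exists (f e); last first.
  by split=> [|_ [e' Le' <-]]; [exists e|apply: fmin; rewrite inE].
have e0 : e != 0 by apply: contraTneq r0 => e0; rewrite -Le e0 qform0 ltxx.
have -> : f e = qform Q (invmx Abar *m e).
  by rewrite /f -{2}[e](mulKVmx Ainv) (lyapunov_qform _ lyap) opprB addrC subrK.
apply: Qdef.2; apply: contraNneq e0 => /(congr1 (mulmx Abar)).
by rewrite mulKVmx// mulmx0 => ->.
Qed.

(** If the image of [e] were above the level [r], then scaling it down to that
    level would exhibit a decrement smaller than [d]. *)
Lemma decrement_contraction (Abar P : 'M[R]_6) (r d : R) e :
  Abar \in unitmx -> sym_posdef P -> 0 < r -> 0 < d ->
  is_min (decrement_set Abar P r) d ->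
  qform P e <= r + d -> qform P (Abar *m e) <= r.
Proof.
move=> Ainv Pdef r0 d0 [_ dmin] erd; rewrite leNgt; apply/negP => rAe.
have Ae0 : Abar *m e != 0.
  by apply: contraTneq rAe => ->; rewrite qform0 -leNgt ltW.
have [a ar] := posdef_scaled_to Pdef (ltW r0) Ae0.
have := dmin _ (ex_intro2 _ _ _ ar erefl).
rewrite -scalemxAr mulKmx// ar qformZ.
move: ar; rewrite qformZ => ar.
have a1 : a ^+ 2 < 1.
  by rewrite ltNge; apply/negP => a1; nra.
by have := qform_ge0 e Pdef; nra.
Qed.

End SafeScaleFactors.

(** * Matrix exponential *)

Section MatrixExponential.
Variable R : realType.

Lemma mx_norm_exp n (M : 'M[R]_n.+1) k :
  `|M ^+ k| <= (n.+1%:R * `|M|) ^+ k.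
Proof.
elim: k => [|k IHk].
  rewrite !expr0; apply: mx_norm_ler => // i j.
  by rewrite mxE; case: eqP; rewrite ?normr1 ?normr0 ?ler01.
rewrite !exprS; apply: le_trans (ler_norm_mulmx _ _) _.
by rewrite ler_wpM2l// mulr_ge0.
Qed.

(** Each coordinate is dominated by the scalar exponential series at
    [n.+1 * `|M|]; the factor [n.+1] makes the maximum norm submultiplicative. *)
Lemma expmx_cvg n (M : 'M[R]_n.+1) :
  series (fun k => (k`!%:R)^-1 *: M ^+ k) @ \oo --> expmx M.
Proof.
set u := fun k => _.
have coord_cvg i j : cvgn (series (fun k => u k i j)).
  apply: normed_cvg; set a := n.+1%:R * `|M|.
  apply: (series_le_cvg _ _ _ (is_cvg_series_exp_coeff a)) => [k|k|k].
  - exact: normr_ge0.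
  - by apply: exp_coeff_ge0; rewrite mulr_ge0.
  - rewrite /u /exp_coeff/= mxE normrM normfV normr_nat mulrC ler_wpM2r//.
    exact: le_trans (ler_coord_mx_norm _ _ _) (mx_norm_exp _ _).
suff /cvgP : series u @ \oo --> \matrix_(i, j) limn (series (fun k => u k i j)).
  exact.
apply: mx_cvg => i j; rewrite mxE.
rewrite [X in X @ _ --> _](_ : _ = series (fun k => u k i j)); last first.
  by apply/funext => N; rewrite /series/= summxE.
exact: coord_cvg.
Qed.

Lemma expmx_mulmx_cvg n p (M : 'M[R]_n.+1) (v : 'M[R]_(n.+1, p)) :
  series (fun k => (k`!%:R)^-1 *: (M ^+ k *m v)) @ \oo --> expmx M *m v.
Proof.
have mulv : continuous (fun A : 'M[R]_n.+1 => A *m v).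
  apply: (@mulmx_continuous _ _ _ _ _ id (cst v)) => A; first exact: id.
  exact: cst_continuous.
rewrite (_ : series _ = (fun A => A *m v) \o
    series (fun k => (k`!%:R)^-1 *: M ^+ k)).
  exact: cvg_comp _ _ (@expmx_cvg _ M) (mulv (expmx M)).
apply/funext => N; rewrite /series/= mulmx_suml.
by apply: eq_bigr => k _; rewrite scalemxAl.
Qed.

(** The powers of [M] send [v] alternately to multiples of [M v] and of [M (M v)],
    with the coefficients of the sine and of the cosine series. This is
    Rodrigues' rotation formula for a rotation of angle [th]. *)
Lemma expmx_rotation n p (M : 'M[R]_n.+1) (v : 'M[R]_(n.+1, p)) (th : R) :
  th != 0 -> M *m (M *m (M *m v)) = - th ^+ 2 *: (M *m v) ->
  expmx M *m v =
    v + (sin th / th) *: (M *m v) + ((1 - cos th) / th ^+ 2) *: (M *m (M *m v)).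
Proof.
move=> th0 M3.
have Modd j : M ^+ j.*2.+1 *m v = (- th ^+ 2) ^+ j *: (M *m v).
  elim: j => [|j IHj]; first by rewrite expr1 expr0 scale1r.
  rewrite doubleS 2!exprS -!mulmxE -!mulmxA.
  by rewrite IHj -!scalemxAr M3 scalerA [in RHS]exprSr.
have Meven j : M ^+ j.+1.*2 *m v = (- th ^+ 2) ^+ j *: (M *m (M *m v)).
  by rewrite doubleS exprS -mulmxE -mulmxA Modd -scalemxAr.
pose c1 := th^-1 *: (M *m v); pose c2 := th ^- 2 *: (M *m (M *m v)).
(* [exp_coeff 0] vanishes except at [k = 0]: it carries the constant term, and
   compensates there the constant term of the cosine series *)
have term k : (k`!%:R)^-1 *: (M ^+ k *m v) =
    exp_coeff 0 k *: (v + c2) + sin_coeff th k *: c1 - cos_coeff th k *: c2.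
  rewrite /exp_coeff /sin_coeff /cos_coeff /= /c1 /c2 expr0n.
  case: k => [|k].
    rewrite /= -exprnP !expr0 !mul0r scale0r addr0 fact0 !divr1 invr1.
    by rewrite !mulr1 !scale1r mul1mx addrK.
  rewrite mul0r scale0r add0r.
  have [j [->|->]] : exists j, k.+1 = j.*2.+1 \/ k.+1 = j.+1.*2.
    by exists k./2; case: (boolP (odd k)) => ok; [right|left]; lia.
  - rewrite Modd /= odd_double /= !mul0r scale0r subr0 !scalerA; congr (_ *: _).
    rewrite mul1r doubleK [(- th ^+ 2) ^+ j]exprNn -exprM mul2n [th ^+ _.+1]exprS.
    by field; rewrite th0 pnatr_eq0 -lt0n fact_gt0.
  - rewrite Meven /= negbK odd_double /= !mul0r scale0r add0r !scalerA.
    rewrite -[RHS]scaleNr; congr (_ *: _).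
    rewrite mul1r doubleK -exprnP [(- th ^+ 2) ^+ j]exprNn -exprM mul2n.
    rewrite doubleS [(-1) ^+ _.+1]exprS [th ^+ j.*2.+2]exprS [th ^+ j.*2.+1]exprS.
    by field; rewrite th0 pnatr_eq0 -lt0n fact_gt0.
have expv := @expmx_mulmx_cvg _ _ M v.
have partial N : series (fun k => (k`!%:R)^-1 *: (M ^+ k *m v)) N =
    series (exp_coeff 0) N *: (v + c2) + series (sin_coeff th) N *: c1
    - series (cos_coeff th) N *: c2.
  rewrite /series/= (eq_bigr _ (fun k _ => term k)) !big_split/= sumrN.
  by rewrite -!scaler_suml.
have lim_rot : series (fun k => (k`!%:R)^-1 *: (M ^+ k *m v)) @ \oo -->
    1 *: (v + c2) + sin th *: c1 - cos th *: c2.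
  rewrite (_ : series _ = fun N => series (exp_coeff 0) N *: (v + c2) +
      series (sin_coeff th) N *: c1 - series (cos_coeff th) N *: c2); last first.
    exact/funext.
  apply: cvgB; first apply: cvgD.
  - rewrite -expR0; apply: cvgZr_tmp; exact: is_cvg_series_exp_coeff.
  - apply: cvgZr_tmp; rewrite unlock; exact: is_cvg_series_sin_coeff.
  - apply: cvgZr_tmp; rewrite unlock; exact: is_cvg_series_cos_coeff.
rewrite (cvg_unique (@norm_hausdorff _ _) expv lim_rot) /c1 /c2.
rewrite scale1r !scalerA mulrBl mul1r scalerBl -!addrA; congr (_ + _).
by rewrite addrCA.
Qed.

(** The angles add up, since [M *m v] and [M *m (M *m v)] satisfy the same cubic
    relation as [v]. *)
Lemma expmx_rotation_iter n p (M : 'M[R]_n.+1) (v : 'M[R]_(n.+1, p)) (th : R)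
    k : th != 0 -> M *m (M *m (M *m v)) = - th ^+ 2 *: (M *m v) ->
  iter k (fun w => expmx M *m w) v =
    v + (sin (th *+ k) / th) *: (M *m v)
      + ((1 - cos (th *+ k)) / th ^+ 2) *: (M *m (M *m v)).
Proof.
move=> th0 M3.
have MZ a w : M *m (a *: w) = a *: (M *m w) :> 'M[R]_(n.+1, p).
  by rewrite -scalemxAr.
have M4 : M *m (M *m (M *m (M *m v))) = - th ^+ 2 *: (M *m (M *m v)).
  by rewrite M3 MZ.
have M5 : M *m (M *m (M *m (M *m (M *m v)))) =
    - th ^+ 2 *: (M *m (M *m (M *m v))).
  by rewrite M4 MZ.
elim: k => [|k IHk].
  by rewrite mulr0n sin0 cos0 subrr !mul0r !scale0r !addr0.
rewrite iterS IHk !mulmxDr -!scalemxAr (expmx_rotation th0 M3).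
rewrite (expmx_rotation th0 M4) (expmx_rotation th0 M5) M4 M3 mulrSr sinD cosD.
apply/matrixP => i j; rewrite !mxE.
by field.
Qed.

End MatrixExponential.

(** * Clohessy-Wiltshire dynamics *)

Section ClohessyWiltshire.
Variable R : realType.

(** The matrix has a nontrivial Jordan block at the eigenvalue 0, responsible for
    the secular drift along the track. The condition [y' = - 2 omega x] selects
    an invariant subspace where the generalized eigenspace of 0 reduces to the
    kernel, and what remains there is an oscillation of frequency [omega]. *)
Lemma cw_Ac_cubed (omega : R) (X : 'cV[R]_6) :
  X (inord 4) 0 = - (2 * omega) * X (inord 0) 0 ->
  cw_Ac omega *m (cw_Ac omega *m (cw_Ac omega *m X)) =
    - omega ^+ 2 *: (cw_Ac omega *m X).
Proof.
move=> X4.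
have row_eq (Y : 'cV[R]_6) i : (cw_Ac omega *m Y) i 0 =
  nth 0 [:: Y (inord 3) 0; Y (inord 4) 0; Y (inord 5) 0;
    3 * omega ^+ 2 * Y (inord 0) 0 + 2 * omega * Y (inord 4) 0;
    - (2 * omega) * Y (inord 3) 0; - omega ^+ 2 * Y (inord 2) 0] i.
  rewrite mxE; under eq_bigr => j _ do rewrite mxE -[j in Y j 0]inord_val.
  rewrite -(big_mkord xpredT (fun j => nth 0 (nth [::] _ i) j * Y (inord j) 0)).
  rewrite /index_iota/= !big_cons big_nil.
  by case: i => -[|[|[|[|[|[|[|i]]]]]]] //= _; ring.
apply/colP => i; rewrite [RHS]mxE !row_eq !inordK//= X4.
by case: i => -[|[|[|[|[|[|i]]]]]] //= _; ring.
Qed.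

(** No acceleration depends on the coordinate [y], so that a displacement along the track
    is an equilibrium. *)
Lemma cw_A_fixes_along_track (omega DT : R) :
  cw_A omega DT *m delta_mx (inord 1) 0 = delta_mx (inord 1) 0 :> 'cV[R]_6.
Proof.
have cw0 : (DT *: cw_Ac omega) *m delta_mx (inord 1) 0 = 0 :> 'cV[R]_6.
  rewrite -scalemxAl -colE; apply/colP => i; rewrite !mxE inordK//=.
  by case: i => -[|[|[|[|[|[|i]]]]]] //= _; rewrite mulr0.
(* the matrix kills the vector, so any nonzero angle fits *)
rewrite /cw_A (@expmx_rotation _ _ _ _ _ 1) ?oner_eq0// !cw0 !mulmx0 ?scaler0//.
by rewrite !addr0.
Qed.

Lemma cw_A_periodic (omega DT : R) N (X : 'cV[R]_6) :
  omega * DT != 0 -> omega * DT *+ N = pi *+ 2 ->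
  X (inord 4) 0 = - (2 * omega) * X (inord 0) 0 ->
  iter N (fun Y => cw_A omega DT *m Y) X = X.
Proof.
move=> th0 period X4; rewrite (expmx_rotation_iter N th0) ?period ?sin2pi ?cos2pi.
  by rewrite subrr !mul0r !scale0r !addr0.
rewrite -!scalemxAl -!scalemxAr (cw_Ac_cubed X4) !scalerA; congr (_ *: _); ring.
Qed.

End ClohessyWiltshire.

(** * Induction and recursion on a cycle *)

(** The number of steps from [k0] backwards to [k] around the cycle, the measure
    along which the backward recursion is well founded. *)
Definition cyclic_dist n (k0 k : 'I_n) : nat :=
  if (k <= k0)%N then (k0 - k)%N else (k0 + n - k)%N.

Lemma val_ordS n (k : 'I_n.+1) :
  ordS k = (if k == n :> nat then 0 else k.+1)%N :> nat.
Proof.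
rewrite /=; have := ltn_ord k; case: eqP => [->|kn] kltn; first by rewrite modnn.
by rewrite modn_small//; lia.
Qed.

Lemma cyclic_dist_ordS n (k0 k : 'I_n.+1) :
  k != k0 -> cyclic_dist k0 k = (cyclic_dist k0 (ordS k)).+1.
Proof.
move=> kk0; have {kk0} : k <> k0 :> nat by move/val_inj/eqP; apply/negP.
rewrite /cyclic_dist val_ordS; have := ltn_ord k; have := ltn_ord k0.
case: (eqVneq (k : nat) n) => kn; rewrite ?leq0n; do 2?case: ifP; lia.
Qed.

Lemma cyclic_ind n (k0 : 'I_n.+1) (T : 'I_n.+1 -> Prop) :
  T k0 -> (forall k, k != k0 -> T (ordS k) -> T k) -> forall k, T k.
Proof.
move=> T0 TS k; move dk : (cyclic_dist k0 k) => d.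
elim: d k dk => [|d IHd] k dk; have [->//|kk0] := eqVneq k k0.
  by move: dk; rewrite cyclic_dist_ordS.
by apply: TS => //; apply: IHd; move: dk; rewrite cyclic_dist_ordS// => -[].
Qed.

Lemma cyclic_rec n T (k0 : 'I_n.+1) (x0 : T) (f : 'I_n.+1 -> T -> T) :
  exists g : 'I_n.+1 -> T,
    g k0 = x0 /\ forall k, k != k0 -> g k = f k (g (ordS k)).
Proof.
pose fix h d k {struct d} := if d is d'.+1 then f k (h d' (ordS k)) else x0.
exists (fun k => h (cyclic_dist k0 k) k); split=> [|k kk0].
  by rewrite /cyclic_dist leqnn subnn.
by rewrite cyclic_dist_ordS.
Qed.

(** * The backward recursion and the tube *)

Section Tubes.
Variables (R : realType) (kmax : nat).

Lemma val_wrap_nat (k : nat) : wrap kmax k%:Z = (k %% kmax.+1)%N :> nat.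
Proof. by rewrite /wrap modz_nat absz_nat inordK// ltn_mod. Qed.

Lemma wrapS (k : nat) : wrap kmax k.+1%:Z = ordS (wrap kmax k%:Z).
Proof.
apply: ord_inj; rewrite val_wrap_nat [RHS]/= val_wrap_nat.
by rewrite -addn1 -[in RHS]addn1 modnDml.
Qed.

Lemma wrap_ord (k : 'I_kmax.+1) : wrap kmax k%:Z = k.
Proof. by apply: ord_inj; rewrite val_wrap_nat modn_small. Qed.

Lemma trajectory_ordS (A : 'M[R]_6) X0 (k : 'I_kmax.+1) :
  iter kmax.+1 (fun X => A *m X) X0 = X0 ->
  trajectory A X0 (ordS k) = A *m trajectory A X0 k.
Proof.
move=> period; rewrite /trajectory val_ordS; case: eqP => [->|_]; last by [].
by rewrite -iterS period.
Qed.

Lemma procedure2_exists (Abar P Q : 'M[R]_6) (rho_s : 'I_kmax.+1 -> R) k0 :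
  Abar \in unitmx -> sym_posdef P -> sym_posdef Q ->
  Abar^T *m P *m Abar - P = - Q -> (forall k, 0 < rho_s k) ->
  exists rho, procedure2 Abar P rho_s k0 rho.
Proof.
move=> Ainv Pdef Qdef lyap s0.
pose D r := xget 0 [set d : R | is_min (decrement_set Abar P r) d].
have Dmin r : 0 < r -> 0 < D r /\ is_min (decrement_set Abar P r) (D r).
  move=> r0; have [d d0 dmin] := decrement_min Ainv Pdef Qdef lyap r0.
  have Dr : is_min (decrement_set Abar P r) (D r) by apply: xgetPex; exists d.
  split => //; apply: lt_le_trans d0 _.
  by apply: dmin.2; exact: Dr.1.
have [rho [rho0 rhoS]] := cyclic_rec k0 (rho_s k0) (fun k r =>
  if rho_s k <= r + D r then rho_s k else r + D r).
have rho_gt0 : forall k, 0 < rho k.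
  apply: (cyclic_ind (k0 := k0)) => [|k kk0 rSk]; first by rewrite rho0.
  by rewrite rhoS//; case: ifP => // _; rewrite addr_gt0// (Dmin _ rSk).1.
exists rho; split => // k kk0; exists (D (rho (ordS k))); last exact: rhoS.
exact: (Dmin _ _).2.
Qed.

Section Procedure2.
Variables (Abar P Q : 'M[R]_6) (rho_s : 'I_kmax.+1 -> R) (k0 : 'I_kmax.+1).
Variable rho : 'I_kmax.+1 -> R.
Hypotheses (Ainv : Abar \in unitmx) (Pdef : sym_posdef P) (Qdef : sym_posdef Q).
Hypothesis lyap : Abar^T *m P *m Abar - P = - Q.
Hypothesis rho_s_gt0 : forall k, 0 < rho_s k.
Hypothesis k0_min : forall k, rho_s k0 <= rho_s k.
Hypothesis rhoP : procedure2 Abar P rho_s k0 rho.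

Lemma procedure2_le k : rho k <= rho_s k.
Proof.
have [->|kk0] := eqVneq k k0; first by rewrite rhoP.1 lexx.
by have [d _ ->] := rhoP.2 _ kk0; case: (leP (rho_s k)) => // /ltW.
Qed.

(** Going backwards, a level is either a safe scale factor or larger than its
    successor, so that it never falls below the starting level. *)
Lemma procedure2_ge k : rho_s k0 <= rho k.
Proof.
elim/(cyclic_ind (k0 := k0)): k => [|k kk0 rSk]; first by rewrite rhoP.1.
have [d dmin ->] := rhoP.2 _ kk0; case: ifP => // _.
have [d' d'0 d'min] :=
  decrement_min Ainv Pdef Qdef lyap (lt_le_trans (rho_s_gt0 k0) rSk).
apply: le_trans rSk _; rewrite lerDl (le_trans (ltW d'0))//.
by apply: d'min.2; exact: dmin.1.
Qed.

Lemma procedure2_gt0 k : 0 < rho k.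
Proof. exact: lt_le_trans (rho_s_gt0 k0) (procedure2_ge k). Qed.

(** Away from [k0] the recursion bounds [rho k] by the level that contracts into
    [rho (ordS k)]. At [k0] it imposes no relation between the two, but there the
    level is the smallest of all, and the decrease of [P] along the closed loop
    suffices. *)
Lemma procedure2_step k e :
  qform P e <= rho k -> qform P (Abar *m e) <= rho (ordS k).
Proof.
have [-> ek0|kk0 ek] := eqVneq k k0.
  apply: le_trans (procedure2_ge _); rewrite -rhoP.1; apply: le_trans ek0.
  by rewrite (lyapunov_qform _ lyap) gerDl oppr_le0 qform_ge0.
have [d dmin rhok] := rhoP.2 _ kk0.
have [d' d'0 d'min] :=
  decrement_min Ainv Pdef Qdef lyap (procedure2_gt0 (ordS k)).
have d0 : 0 < d by apply: lt_le_trans d'0 _; apply: d'min.2; exact: dmin.1.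
apply: (decrement_contraction Ainv Pdef _ d0 dmin); first exact: procedure2_gt0.
by apply: le_trans ek _; rewrite rhok; case: ifP.
Qed.

End Procedure2.
End Tubes.

Theorem theorem4 (R : realType) (omega mass DT : R) (kmax : nat)
    (X0 : 'cV[R]_6) (K : 'M[R]_(3, 6)) (P Q : 'M[R]_6) (umax : R)
    (l : nat) (s : 'I_l -> 'cV[R]_3) (S : 'I_l -> 'M[R]_3) :
  let A := cw_A omega DT in
  let B := cw_B omega mass DT in
  let Abar := A + B *m K in
  let Xn := trajectory (kmax := kmax) A X0 in
  0 < omega -> 0 < mass -> 0 < DT ->
  (2 * pi / omega) / DT = kmax.+1%:R ->
  X0 (inord 4) 0 = - (2 * omega) * X0 (inord 0) 0 ->
  (forall i, sym_posdef (S i)) ->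
  schur Abar ->
  Abar \in unitmx ->
  sym_posdef P -> sym_posdef Q ->
  Abar^T *m P *m Abar - P = - Q ->
  0 < umax ->
  (forall i, range Xn `&` exclusion_zone (s i) (S i) = set0) ->
  exists rho_s : 'I_kmax.+1 -> R,
    safe_scale_factors K P umax s S Xn rho_s /\
    forall k0 : 'I_kmax.+1, (forall j, rho_s k0 <= rho_s j) ->
    exists rho : 'I_kmax.+1 -> R,
      [/\ forall k, 0 < rho k,
          procedure2 Abar P rho_s k0 rho,
          safe_tube K umax s S Xn (tube P Xn rho)
        & positively_invariant Abar (B *m K) P Xn rho].
Proof.
move=> A B Abar Xn omega_gt0 _ DT_gt0 period X04 _ _ Ainv Pdef Qdef lyap umax_gt0.
move=> avoid.
(* with [K = 0] the vector [v] would be fixed by the closed loop, hence its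
   [Q]-level would vanish *)
have K0 : K != 0.
  apply/eqP => K0; pose v : 'cV[R]_6 := delta_mx (inord 1) 0.
  have v0 : v != 0.
    by apply/eqP => /colP/(_ (inord 1))/eqP; rewrite !mxE !eqxx oner_eq0.
  have Av : Abar *m v = v.
    by rewrite /Abar K0 mulmx0 addr0 cw_A_fixes_along_track.
  have := lyapunov_qform v lyap; rewrite Av => /esym/eqP.
  rewrite addrC -subr_eq0 addrK oppr_eq0 => /eqP Qv.
  by have := Qdef.2 _ v0; rewrite Qv ltxx.
have Xn_avoids k i : ~ exclusion_zone (s i) (S i) (Xn k).
  by move=> XO; rewrite -[False]/(set0 (Xn k)) -(avoid i); split => //; exists k.
have XnS k : Xn (ordS k) = A *m Xn k.
  apply: trajectory_ordS; apply: cw_A_periodic => //.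
    by rewrite mulf_neq0// gt_eqF.
  rewrite -mulr_natr -period -mulr_natl; field.
  by rewrite !gt_eqF.
have rho_u_ex k : {r | 0 < r /\ is_max (rho_u_set K P umax (Xn k)) r}.
  by apply/cid; have [r r0 ?] := rho_u_max (Xn k) Pdef umax_gt0 K0; exists r.
have rho_O_ex k i : {r | 0 < r /\ is_min (rho_O_set P (s i) (S i) (Xn k)) r}.
  by apply/cid; have [r r0 ?] := rho_O_min Pdef (Xn_avoids k i); exists r.
pose rho_u k := sval (rho_u_ex k); pose rho_O k i := sval (rho_O_ex k i).
pose rho_s k := \big[Order.min/rho_u k]_(i < l) rho_O k i.
have rho_s_gt0 k : 0 < rho_s k.
  apply: lt_bigmin => [|i _]; first exact: (svalP (rho_u_ex k)).1.
  exact: (svalP (rho_O_ex k i)).1.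
exists rho_s; split=> [k|k0 k0_min].
  exists (rho_u k), (rho_O k); split => // [|i].
    exact: (svalP (rho_u_ex k)).2.
  exact: (svalP (rho_O_ex k i)).2.
have [rho rhoP] := procedure2_exists k0 Ainv Pdef Qdef lyap rho_s_gt0.
exists rho; split => //.
- exact: procedure2_gt0 Ainv Pdef Qdef lyap rho_s_gt0 k0_min rhoP.
- move=> X [j _]; rewrite /ellipsoid/= => Xj k.
  have {}Xj : qform P (X - Xn j) <= rho_s j.
    exact: le_trans Xj (procedure2_le rhoP j).
  split=> [i|].
    rewrite subr_le0; apply: (rho_O_min_safe Pdef (Xn_avoids j i)).
      exact: (svalP (rho_O_ex j i)).2.
    exact: le_trans Xj (bigmin_le _ _ _).
  (* the shift that makes the reference at time [k] the centre of the ellipsoid *)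
  exists (j%:Z - k%:Z); rewrite [k%:Z + _]addrC subrK wrap_ord.
  by apply: (svalP (rho_u_ex j)).2.1.2; exact: le_trans Xj (bigmin_le_id _ _ _ _).
(* the tube is invariant without shift, as the recursion links each ellipsoid to
   the next one in time *)
- exists 0 => k1 X dyn Xk1 k2 /subnKC <-.
  elim: (k2 - k1)%N => [|d]; first by rewrite addn0.
  rewrite addnS !addr0 wrapS /ellipsoid /= => Xd.
  have -> : X (k1 + d).+1 - Xn (ordS (wrap kmax (k1 + d)%N%:Z)) =
      Abar *m (X (k1 + d)%N - Xn (wrap kmax (k1 + d)%N%:Z)).
    rewrite dyn ?leq_addr// addr0 XnS mulmxBr [X in _ = _ - X]mulmxDl.
    by rewrite opprD addrA addrAC.
  exact: procedure2_step Ainv Pdef Qdef lyap rho_s_gt0 k0_min rhoP _ _ Xd.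
Qed.
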